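(* Let $G\le(\mathbb{C}^\times)^{n+1}$ be a group and let $W$ and $W'$ be Calabi-Yau polynomials in $n+1$ variables which are invariant under the action of $G$. Then the weight vectors of the two dual quotient Landau-Ginzburg models $([\mathbb{C}^{n+1}/G^T],W^T_{G^T})$ and $([\mathbb{C}^{n+1}/G^{T'}],W'^T_{G^{T'}})$ coincide and form a cyclic subgroup of $\operatorname{Hom}(M^\tau,\mathbb{Z})$, where $M=F((\mathbb{C}^\times)^{n+1}/G)$, and for a generator $q_0$ of this subgroup the associated non-linear sigma-models $Z^{q_0}_{W^T,G^T}$ and $Z^{q_0}_{W'^T,G^{T'}}$ are birational.
   Context: Notation. For an abelian group $H$ that is a finite direct sum of algebraic tori and finitely generated groups (or isomorphic to such), $F(H)=\operatorname{Hom}(H,\mathbb{C}^\times)$ and $H^\tau=\operatorname{Hom}(H,\mathbb{Z})$, with homomorphisms of algebraic groups (so $\operatorname{Hom}(\mathbb{C}^\times,\mathbb{C}^\times)=\mathbb{Z}$); both are contravariant functors, and $F(\mathbb{Z}^{\ell})=(\mathbb{C}^\times)^{\ell}$, $F((\mathbb{C}^\times)^\ell)=\mathbb{Z}^\ell$. Finitely generated free abelian groups are identified with their double $\tau$-duals. $(+)\colon\mathbb{C}^{\ell}\to\mathbb{C}$ denotes the sum of the coordinates. Polynomials. To $W=\sum_{j=0}^m\prod_{i=0}^nX_i^{p_{ij}}\colon\mathbb{C}^{n+1}\to\mathbb{C}$ (nonnegative integer exponents, distinct monomials) one associates the matrix $P=(p_{ij})\colon\mathbb{Z}^{m+1}\to\mathbb{Z}^{n+1}$;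 on $(\mathbb{C}^\times)^{n+1}$ one has $W=(+)\circ F(P)$. $W$ is called Calabi-Yau if $P$ is square (so $m=n$) and invertible over $\mathbb{Q}$, the row vector $(1,\dots,1)\operatorname{ag}(P)$ has all entries $>0$ or all entries $<0$, and $(1,\dots,1)\operatorname{ag}(P)(1,\dots,1)^\tau=\det(P)$, where $\operatorname{ag}(P)$ is the adjugate matrix of $P$. Quotient Landau-Ginzburg model. This is a pair $([\mathbb{C}^{n+1}/G],W_G)$, together with the data $(\mathbb{C}^{n+1},W,G)$, where $G\le(\mathbb{C}^\times)^{n+1}$ is a closed subgroup (acting by coordinatewise multiplication) under which $W$ is invariant, and $W_G$ is the function to which $W$ descends. Put $M=F((\mathbb{C}^\times)^{n+1}/G)$, and let $A=F(\text{quotient map})\colon M\to\mathbb{Z}^{n+1}$ (the inclusion of the lattice of $G$-invariant characters). Since $W$ is $G$-invariant, $P$ factors uniquely as $P=A\circ B^\tau$ with $B^\tau\colon\mathbb{Z}^{m+1}\to M$, and $W_G=(+)\circ F(B^\tau)$ on $(\mathbb{C}^\times)^{n+1}/G=F(M)$. Let $B\colon M^\tau\to(\mathbb{Z}^{m+1})^\tau$ be the transpose of $B^\tau$ and $A^\tau\colon(\mathbb{Z}^{n+1})^\tau\to M^\tau$ the transpose of $A$. Dual. The dual $([\mathbb{C}^{m+1}/G^T],W^T_{G^T})$ is given by the matrix $P^T=P^\tau$ (the transpose), i.e. $W^T=\sum_{i=0}^n\prod_{j=0}^mY_j^{p_{ij}}$, and the group $G^T=\ker F(B)\le F((\mathbb{Z}^{m+1})^\tau)=(\mathbb{C}^\times)^{m+1}$.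 Its factorization is $P^\tau=B\circ A^\tau$ through $M^\tau$: that is, $M^\tau$, $B$, $A^\tau$ play for the dual the roles that $M$, $A$, $B^\tau$ play for the original model, and $(\mathbb{C}^\times)^{m+1}/G^T$ is identified with $F(M^\tau)$ via $F(B)$ (when $P$ is invertible over $\mathbb{Q}$, $F(B)$ is surjective). For $W'$, with matrix $P'$, the corresponding data are $P'=A\circ B'^\tau$, $W'^T$ and $G^{T'}=\ker F(B')$. Weight vectors. A weight vector of $([\mathbb{C}^{n+1}/G],W_G)$ is a homomorphism $q\colon M\to\mathbb{Z}$ with $qB^\tau(e_j-e_k)=0$ for all $j,k$, where $e_0,\dots,e_m$ is the standard basis of $\mathbb{Z}^{m+1}$. Thus a weight vector of the dual is a homomorphism $q\colon M^\tau\to\mathbb{Z}$ with $qA^\tau(e_j-e_k)=0$ for all $j,k$, with $e_0,\dots,e_n$ the standard basis of $(\mathbb{Z}^{n+1})^\tau$. Associated non-linear sigma-model. Given a weight vector $q$, the equation $W_G=0$ defines a hypersurface $Z^q_{W,G}$ in the quotient (stack) $[((\mathbb{C}^\times)^{n+1}/G)/\mathbb{C}^\times]$, where $\mathbb{C}^\times=F(\mathbb{Z})$ acts through the homomorphism $F(q)\colon\mathbb{C}^\times\to(\mathbb{C}^\times)^{n+1}/G=F(M)$. The same definition applied to the dual gives $Z^q_{W^T,G^T}$. *)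

(* Defs.v *)
From HB Require Import structures.
From mathcomp Require Import all_boot all_order all_algebra.
From mathcomp Require Import boolp classical_sets functions reals.
From mathcomp Require Import complex.

Set Implicit Arguments.
Unset Strict Implicit.
Unset Printing Implicit Defensive.
Import Order.TTheory GRing.Theory Num.Theory.

Local Open Scope classical_set_scope.
Local Open Scope ring_scope.

(* H^tau = Hom(H, Z), as a zmodType under pointwise addition. *)
Section TauDual.
Variable H : zmodType.

Definition tau_pred : {pred H -> int} :=
  fun f => `[< forall a b, f (a + b) = f a + f b >].

Lemma tau_predP (f : H -> int) :
  reflect (forall a b, f (a + b) = f a + f b) (f \in tau_pred).
Proof. exact: asboolP. Qed.

Lemma tau_closed : zmod_closed tau_pred.
Proof.
split; first by apply/tau_predP => a b; rewrite addr0.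
move=> f g /tau_predP fD /tau_predP gD; apply/tau_predP => a b.
by rewrite !addrfctE !opprfctE fD gD opprD addrACA.
Qed.

HB.instance Definition _ := GRing.isZmodClosed.Build (H -> int) tau_pred tau_closed.

Record tau := Tau { tau_fun :> H -> int; tau_funP : tau_fun \in tau_pred }.

HB.instance Definition _ := [isSub for tau_fun].
HB.instance Definition _ := [Choice of tau by <:].
HB.instance Definition _ := [SubChoice_isSubZmodule of tau by <:].

End TauDual.

(* F(L) = Hom(L, C^x) for a lattice L: the points of the torus with character
   lattice L.  The values are automatically nonzero.  In particular (C^x)^l is
   F(Z^l), the i-th coordinate of a point being its value at e_i. *)
Section Torus.
Variable R : realType.
Local Notation C := (R[i]).

Record torus (L : zmodType) := Torus {
  tval :> L -> C;
  tval0 : tval 0 = 1;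
  tvalD : forall a b, tval (a + b) = tval a * tval b }.

Section Ops.
Variable L : zmodType.
Implicit Types x y : torus L.

Lemma tvalN x l : x (- l) = (x l)^-1.
Proof.
have xNl : x (- l) * x l = 1 by rewrite -tvalD addNr tval0.
have xl0 : x l != 0.
  by apply/eqP => xl0; move: xNl; rewrite xl0 mulr0 => /esym/eqP; rewrite oner_eq0.
by rewrite -[LHS](mulfK xl0) xNl mul1r.
Qed.

Lemma torus1_subproof (a b : L) : (1 : C) = 1 * 1.
Proof. by rewrite mulr1. Qed.
Definition torus1 : torus L := @Torus L (fun=> 1) erefl torus1_subproof.

Lemma torusM_subproof0 x y : x 0 * y 0 = 1.
Proof. by rewrite !tval0 mulr1. Qed.
Lemma torusM_subproofD x y a b :
  x (a + b) * y (a + b) = (x a * y a) * (x b * y b).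
Proof. by rewrite !tvalD mulrACA. Qed.
Definition torusM x y : torus L :=
  @Torus L (fun l => x l * y l) (torusM_subproof0 x y) (torusM_subproofD x y).

Lemma torusV_subproof0 x : (x 0)^-1 = 1.
Proof. by rewrite tval0 invr1. Qed.
Lemma torusV_subproofD x a b : (x (a + b))^-1 = (x a)^-1 * (x b)^-1.
Proof. by rewrite tvalD invfM. Qed.
Definition torusV x : torus L :=
  @Torus L (fun l => (x l)^-1) (torusV_subproof0 x) (torusV_subproofD x).

(* The coordinate ring of F(L) is the group algebra of L. *)
Definition laurent (f : torus L -> C) : Prop :=
  exists (N : nat) (c : 'I_N -> C) (l : 'I_N -> L),
    forall x, f x = \sum_(k < N) c k * x (l k).

Definition zariski_closed (Z : set (torus L)) : Prop :=
  exists S : set (torus L -> C),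
    (forall f, S f -> laurent f) /\
    Z = [set x | forall f, S f -> f x = 0].

Definition closed_subgroup (G : set (torus L)) : Prop :=
  [/\ zariski_closed G, G torus1,
      forall x y, G x -> G y -> G (torusM x y) &
      forall x, G x -> G (torusV x)].

End Ops.

(* The quotient stack [X / C^x], where X is a subset of F(L) and t in C^x acts
   on F(L) through F(q), that is (t . x)(l) = t ^ q(l) * x(l). *)
Record torus_qstack := TorusQStack {
  qs_lattice : zmodType;
  qs_locus : set (torus qs_lattice);
  qs_weight : tau qs_lattice }.
Arguments qs_locus : clear implicits.
Arguments qs_weight : clear implicits.

Section QuotientStack.
Variable X : torus_qstack.
Local Notation T := (torus (qs_lattice X)).
Implicit Types (x y : T) (t : C) (U V : set T).

Definition translates t x y : Prop :=
  t != 0 /\ forall l, y l = t ^ (qs_weight X l) * x l.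

Definition same_orbit x y : Prop := exists t, translates t x y.

Definition stabilizer x : set C := [set t | translates t x x].

Definition rel_open U : Prop :=
  exists2 Z, zariski_closed Z & U = qs_locus X `\` Z.

Definition invariant_open U : Prop :=
  rel_open U /\ forall x y, same_orbit x y -> U x -> U y.

Definition dense_open U : Prop :=
  invariant_open U /\ forall V, rel_open V -> V !=set0 -> (U `&` V) !=set0.

(* The sections over U / C^x of the structure sheaf of X / C^x: invariant
   functions which are locally on U a fraction of Laurent polynomials. *)
Definition invariant_regular U (f : T -> C) : Prop :=
  (forall x y, same_orbit x y -> U x -> f x = f y) /\
  forall x, U x -> exists a b : T -> C,
    [/\ laurent a, laurent b, b x != 0 &
        forall y, U y -> b y != 0 -> f y = a y / b y].

End QuotientStack.

(* phi represents a morphism U / C^x -> U' / C^x; only the induced map on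
   orbits matters, so that phi itself need not be algebraic. *)
Definition quotient_morphism (X X' : torus_qstack)
    (U : set (torus (qs_lattice X))) (U' : set (torus (qs_lattice X')))
    (phi : torus (qs_lattice X) -> torus (qs_lattice X')) : Prop :=
  [/\ forall x, U x -> U' (phi x),
      forall x y, U x -> U y -> same_orbit x y -> same_orbit (phi x) (phi y) &
      forall V', invariant_open V' -> V' `<=` U' ->
        invariant_open (U `&` phi @^-1` V') /\
        forall f, invariant_regular V' f ->
          invariant_regular (U `&` phi @^-1` V') (f \o phi)].

(* Some dense open substacks have isomorphic coarse quotients, with the same
   stabilizers at corresponding points.  This is birationality of the stacks
   [X / C^x] and [X' / C^x] with reduced X and X': since C^x acts by
   translations through F(q), all stabilizers of X are equal to K = ker F(q),
   and X -> X / C^x is a torsor under C^x / K, which is trivial or isomorphic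
   to C^x.  Such torsors being Zariski locally trivial, [X / C^x] is Zariski
   locally the product of the coarse quotient and BK. *)
Definition birational (X X' : torus_qstack) : Prop :=
  exists (U : set (torus (qs_lattice X))) (U' : set (torus (qs_lattice X')))
         (phi : torus (qs_lattice X) -> torus (qs_lattice X'))
         (psi : torus (qs_lattice X') -> torus (qs_lattice X)),
    [/\ dense_open U /\ dense_open U',
        quotient_morphism U U' phi /\ quotient_morphism U' U psi,
        forall x, U x -> same_orbit (psi (phi x)) x,
        forall x', U' x' -> same_orbit (phi (psi x')) x' &
        forall x, U x -> stabilizer x = stabilizer (phi x)].

(* M = F((C^x)^n / G), the lattice of G-invariant characters in Z^n; the
   inclusion A : M -> Z^n is \val. *)
Section InvariantLattice.
Variables (n : nat) (G : set (torus 'cV[int]_n)).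

Definition invlat_pred : {pred 'cV[int]_n} :=
  fun v => `[< forall g, G g -> g v = 1 >].

Lemma invlat_predP v :
  reflect (forall g, G g -> g v = 1) (v \in invlat_pred).
Proof. exact: asboolP. Qed.

Lemma invlat_closed : zmod_closed invlat_pred.
Proof.
split; first by apply/invlat_predP => g _; rewrite tval0.
move=> u v /invlat_predP uG /invlat_predP vG; apply/invlat_predP => g Gg.
by rewrite tvalD tvalN uG // vG // invr1 mulr1.
Qed.

HB.instance Definition _ :=
  GRing.isZmodClosed.Build 'cV[int]_n invlat_pred invlat_closed.

Record invlat := InvLat { invlat_val : 'cV[int]_n;
                          invlat_valP : invlat_val \in invlat_pred }.

HB.instance Definition _ := [isSub for invlat_val].
HB.instance Definition _ := [Choice of invlat by <:].
HB.instance Definition _ := [SubChoice_isSubZmodule of invlat by <:].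

End InvariantLattice.

Definition int_mx n m (P : 'M[nat]_(n, m)) : 'M[int]_(n, m) :=
  map_mx Posz P.

(* The polynomial W with exponent matrix P: the j-th monomial is the j-th
   column of P. *)
Definition poly_fun n m (P : 'M[nat]_(n, m)) (z : 'cV[C]_n) : C :=
  \sum_(j < m) \prod_(i < n) z i 0 ^+ P i j.

Definition calabi_yau n (P : 'M[nat]_n) : Prop :=
  let w := const_mx 1 *m \adj (int_mx P) : 'rV[int]_n in
  [/\ map_mx (fun k : nat => k%:R : rat) P \in unitmx,
      (forall j, 0 < w 0 j) \/ (forall j, w 0 j < 0) &
      (w *m (const_mx 1 : 'cV[int]_n)) 0 0 = \det (int_mx P)].

Definition invariant_under n m (P : 'M[nat]_(n, m))
    (G : set (torus 'cV[int]_n)) : Prop :=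
  forall g, G g -> forall z : 'cV[C]_n,
    poly_fun P (\col_i (g (delta_mx i 0) * z i 0)) = poly_fun P z.

(* The quotient Landau-Ginzburg model ([C^n / G], W_G), W having the exponent
   matrix P. *)
Section Model.
Variables (n m : nat) (P : 'M[nat]_(n, m)) (G : set (torus 'cV[int]_n)).

(* B^tau : Z^m -> M with P = A o B^tau.  When W is G-invariant, P maps Z^m to
   M and the default value 0 of insubd is not used. *)
Definition Btau (v : 'cV[int]_m) : invlat G := insubd 0 (int_mx P *m v).

(* W_G on (C^x)^n / G = F(M), that is (+) o F(B^tau). *)
Definition quotient_potential (x : torus (invlat G)) : C :=
  \sum_(j < m) x (Btau (delta_mx j 0)).

Definition weight_vectors : set (tau (invlat G)) :=
  [set q | forall j k : 'I_m, q (Btau (delta_mx j 0 - delta_mx k 0)) = 0].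

(* Z^q_{W,G} *)
Definition sigma_model (q : tau (invlat G)) : torus_qstack :=
  TorusQStack [set x | quotient_potential x = 0] q.

(* B : M^tau -> (Z^m)^tau, phi |-> phi o B^tau, in the dual basis of (Z^m)^tau. *)
Definition Bmap (phi : tau (invlat G)) : 'cV[int]_m :=
  \col_j phi (Btau (delta_mx j 0)).

(* G^T = ker F(B); the dual model is given by P^T and G^T. *)
Definition dual_group : set (torus 'cV[int]_m) :=
  [set y | forall phi, y (Bmap phi) = 1].

Lemma Bmap_invlat phi : Bmap phi \in invlat_pred dual_group.
Proof. by apply/invlat_predP => y; apply. Qed.

(* B with values in F((C^x)^m / G^T): the homomorphism by which M^tau is
   identified with the character lattice of (C^x)^m / G^T. *)
Definition Bdual (phi : tau (invlat G)) : invlat dual_group :=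
  InvLat (Bmap_invlat phi).

End Model.

(* q in Hom(M^tau, Z) and q' in Hom(F((C^x)^m / G^T), Z) are identified via B. *)
Definition corresponds n m (P : 'M[nat]_(n, m)) (G : set (torus 'cV[int]_n))
    (q : tau (tau (invlat G))) (q' : tau (invlat (dual_group P G))) : Prop :=
  forall phi, q phi = q' (Bdual P phi).

Definition dual_weight_vectors n m (P : 'M[nat]_(n, m))
    (G : set (torus 'cV[int]_n)) : set (tau (tau (invlat G))) :=
  [set q | exists2 q' : tau (invlat (dual_group P G)),
             weight_vectors P^T q' & @corresponds n m P G q q'].

Definition generates (H : zmodType) (q : H) (S : set H) : Prop :=
  S = [set q *~ k | k in [set: int]].

End Torus.

Arguments dual_weight_vectors {R n m} P G q : rename.

(* Main.v *)
(** The homomorphism A^tau : (Z^(n+1))^tau -> M^tau does not involve W.  The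
    point is that B identifies M^tau with the character lattice of
    (C^x)^(n+1) / G^T: injectivity of B follows from P adj(P) = det(P) 1, and
    surjectivity from a primitive root of unity of order |det(P)|.  Under this
    identification the weight vectors of the dual are the q : M^tau -> Z that
    are constant on the A^tau(e_i), hence determined by one integer, and the
    dual potential is the sum of the coordinates x(A^tau(e_i)).  Both depend
    on G only, so that the two sigma-models are even isomorphic, through the
    isomorphism of lattices B' o B^-1. *)

Require Import Defs.
From HB Require Import structures.
From mathcomp Require Import all_boot all_order all_algebra.
From mathcomp Require Import boolp classical_sets functions reals.
From mathcomp Require Import complex.
From mathcomp Require Import cyclic separable cyclotomic.

Set Implicit Arguments.
Unset Strict Implicit.
Unset Printing Implicit Defensive.

Import Order.TTheory GRing.Theory Num.Theory.
Local Open Scope classical_set_scope.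
Local Open Scope ring_scope.

Arguments qs_locus {R} _.
Arguments qs_weight {R} _.

(** * The dual group Hom(H, Z) *)

Lemma tau_zmod_morphism (H : zmodType) (f : tau H) : zmod_morphism f.
Proof.
have fD := tau_predP _ (tau_funP f); move=> a b.
by apply/(addIr (f b)); rewrite -fD !subrK.
Qed.

HB.instance Definition _ (H : zmodType) (f : tau H) :=
  GRing.isZmodMorphism.Build H int f (tau_zmod_morphism f).

Lemma tauP (H : zmodType) (f g : tau H) : f =1 g -> f = g.
Proof. by move=> fg; apply/val_inj/funext. Qed.

Lemma tau_of_additive (H : zmodType) (f : H -> int) :
  {morph f : a b / a + b} -> exists g : tau H, g =1 f.
Proof. by move=> /tau_predP fP; exists (Tau fP). Qed.

Lemma tau_evalD (H : zmodType) (a : H) :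
  (fun f : tau H => f a) \in @tau_pred (tau H).
Proof. exact/tau_predP. Qed.

(** The canonical map to the double dual. It makes the additivity of [f a] in [f] available, and
    later embeds the weight vectors into Z. *)
Definition tau_eval (H : zmodType) (a : H) : tau (tau H) := Tau (tau_evalD a).

Lemma tauB (H : zmodType) (f g : tau H) a : (f - g) a = f a - g a.
Proof. exact: (raddfB (tau_eval a)). Qed.

(** * Cyclic subgroups *)

Lemma subgroupMz (H : zmodType) (S : set H) a (k : int) :
  S 0 -> (forall a b, S a -> S b -> S (a - b)) -> S a -> S (a *~ k).
Proof.
move=> S0 SB Sa.
have SN b : S b -> S (- b) by move=> Sb; rewrite -sub0r; exact: SB.
have Sn j : S (a *+ j).
  elim: j => [|j IH]; first by rewrite mulr0n.
  by rewrite mulrSr -[X in _ + X]opprK; apply: SB => //; exact: SN.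
by case: k => k; rewrite ?NegzE ?mulrNz -?pmulrn; [|apply: SN]; exact: Sn.
Qed.

(** The least positive element works, since a nonzero remainder modulo it would be a smaller
    positive element of [S]; if [S] is zero, [d = 0]. *)
Lemma int_subgroup_cyclic (S : set int) :
  S 0 -> (forall a b, S a -> S b -> S (a - b)) ->
  exists2 d, S d & forall a, S a -> (d %| a)%Z.
Proof.
move=> S0 SB.
have SM a k : S a -> S (a * k) by rewrite -mulrzz; exact: subgroupMz.
have [[a Sa a0]|noS] := pselect (exists2 a, S a & a != 0); last first.
  exists 0 => // a Sa; rewrite dvd0z; apply/negPn/negP => a0.
  by case: noS; exists a.
pose p := fun j : nat => `[< (0 < j)%N /\ S j >].
have exp : exists j, p j.
  exists `|a|%N; apply/asboolP; split; first by rewrite absz_gt0.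
  by rewrite abszEsign mulrC; apply: SM.
have [d /asboolP[d0 Sd] dmin] := ex_minnP exp; exists d => // b Sb.
have d0z : d%:Z != 0 by rewrite -lt0n.
apply/dvdz_mod0P; case E: (b %% d)%Z => [[//|r]|r]; last first.
  by have := modz_ge0 b d0z; rewrite E.
have : p r.+1.
  apply/asboolP; split=> //; rewrite -E.
  have -> : (b %% d)%Z = b - d%:Z * (b %/ d)%Z.
    by rewrite {2}(divz_eq b d) mulrC addrC addKr.
  by apply: SB => //; exact: SM.
move=> /dmin; have := ltz_mod b d0z.
by rewrite E ltz_nat ltnNge => /negP.
Qed.

(** The image of [S] in Z is generated by some [c a], and [c] is injective on [S]. *)
Lemma generates_of_int (H : zmodType) (S : set H) (c : tau H) :
  S 0 -> (forall a b, S a -> S b -> S (a - b)) ->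
  (forall a, S a -> c a = 0 -> a = 0) -> exists a, generates a S.
Proof.
move=> S0 SB c_inj.
have [||_ [a Sa <-] cS] := @int_subgroup_cyclic (c @` S).
- by exists 0; rewrite ?raddf0.
- move=> _ _ [a Sa <-] [b Sb <-]; exists (a - b); last exact: raddfB.
  exact: SB.
exists a; apply/seteqP; split=> [b Sb|_ [k _ <-]]; last exact: subgroupMz.
have /dvdzP[k ck] : (c a %| c b)%Z by apply: cS; exists b.
exists k => //; apply/eqP; rewrite eq_sym -subr_eq0; apply/eqP/c_inj.
  by apply: (SB) => //; exact: subgroupMz.
by rewrite raddfB raddfMz mulrzz mulrC -ck subrr.
Qed.

(** * Primitive roots of unity *)

(** X^n - 1 splits and, in characteristic 0, is separable; its n distinct roots then include a
    primitive one. *)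
Lemma closed_prim_root_exists (F : numClosedFieldType) n :
  (0 < n)%N -> exists z : F, n.-primitive_root z.
Proof.
pose p : {poly F} := 'X^n - 1; have [r Dp] := closed_field_poly_normal p.
move=> n_gt0; rewrite (monicP _) ?monicXnsubC // scale1r in Dp.
have rn1 : all n.-unity_root r by apply/allP => z; rewrite -root_prod_XsubC -Dp.
have sz_r : (n <= size r)%N.
  by rewrite -ltnS -(size_prod_XsubC r id) -Dp size_XnsubC.
have [|z] := hasP (has_prim_root n_gt0 rn1 _ sz_r); last by exists z.
by rewrite -separable_prod_XsubC -Dp separable_Xn_sub_1 // pnatr_eq0 -lt0n.
Qed.

Lemma prim_order_dvdz (F : fieldType) n (z : F) (k : int) :
  n.-primitive_root z -> (n %| k)%Z = (z ^ k == 1).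
Proof.
move=> zP; rewrite dvdzE (prim_order_dvd zP).
by case: k => k; rewrite ?NegzE -?exprnN -?exprnP ?invr_eq1.
Qed.

(** * Maps of tori and quotient stacks induced by lattice homomorphisms *)

Section Torus.
Variable R : realType.

Lemma tvalMz (L : zmodType) (x : torus R L) l (k : int) :
  x (l *~ k) = x l ^ k.
Proof.
have xM j : x (l *+ j) = x l ^+ j.
  by elim: j => [|j IH]; rewrite ?tval0 // mulrS exprS tvalD IH.
by case: k => k; rewrite ?NegzE ?mulrNz -?exprnN ?tvalN -?pmulrn -?exprnP xM.
Qed.

Lemma col_sum_delta n (v : 'cV[int]_n) : v = \sum_i delta_mx i 0 *~ v i 0.
Proof.
rewrite {1}[v]matrix_sum_delta; apply: eq_bigr => i _.
by rewrite big_ord1 -scaler_int intz.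
Qed.

Lemma tval_col n (x : torus R 'cV[int]_n) v :
  x v = \prod_i x (delta_mx i 0) ^ v i 0.
Proof.
rewrite {1}[v]col_sum_delta (big_morph x (tvalD x) (tval0 x)).
by apply: eq_bigr => i _; rewrite tvalMz.
Qed.

Section LatticeMorphism.
Variables (L L' : zmodType) (f : L' -> L).
Hypothesis fD : {morph f : a b / a + b}.

Lemma torus_comp_subproof0 (x : torus R L) : x (f 0) = 1.
Proof.
rewrite (_ : f 0 = 0) ?tval0 //.
by apply: (addrI (f 0)); rewrite -fD !addr0.
Qed.

Lemma torus_comp_subproofD (x : torus R L) a b :
  x (f (a + b)) = x (f a) * x (f b).
Proof. by rewrite fD tvalD. Qed.

Definition torus_comp (x : torus R L) : torus R L' :=
  Torus (torus_comp_subproof0 x) (torus_comp_subproofD x).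

Lemma laurent_comp (h : torus R L' -> R[i]) :
  laurent h -> laurent (h \o torus_comp).
Proof. by case=> N [c [l hE]]; exists N, c, (f \o l) => x; rewrite /= hE. Qed.

Lemma zariski_closed_comp (Z : set (torus R L')) :
  zariski_closed Z -> zariski_closed (torus_comp @^-1` Z).
Proof.
case=> S [Slaurent ->]; exists [set h \o torus_comp | h in S]; split.
  by move=> _ [h Sh <-]; apply/laurent_comp/Slaurent.
apply/seteqP; split=> x /= xS; first by move=> _ [h Sh <-]; exact: xS.
by move=> h Sh; apply: (xS (h \o torus_comp)); exists h.
Qed.

End LatticeMorphism.

Lemma zariski_closed0 (L : zmodType) : zariski_closed (set0 : set (torus R L)).
Proof.
exists [set fun=> 1]; split.
  move=> _ ->; exists 1, (fun=> 1), (fun=> 0) => x.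
  by rewrite big_ord1 tval0 mulr1.
apply/seteqP; split=> // x /(_ _ erefl) /eqP.
by rewrite oner_eq0.
Qed.

Definition orbit_closed (X : torus_qstack R)
    (U : set (torus R (qs_lattice X))) :=
  forall x y, same_orbit x y -> U x -> U y.

Lemma dense_open_locus (X : torus_qstack R) :
  orbit_closed (qs_locus X) -> dense_open (qs_locus X).
Proof.
move=> Xinv; split; first split=> //.
  by exists set0; [exact: zariski_closed0 | rewrite setD0].
by move=> V [Z _ ->] [x Vx]; exists x; split=> //; case: Vx.
Qed.

Section StackMorphism.
Variables (X X' : torus_qstack R) (f : qs_lattice X' -> qs_lattice X).
Hypothesis fD : {morph f : a b / a + b}.
Hypothesis f_weight : forall l, qs_weight X (f l) = qs_weight X' l.

Lemma translates_comp t x y :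
  translates t x y -> translates t (torus_comp fD x) (torus_comp fD y).
Proof. by case=> t0 xy; split=> // l /=; rewrite xy f_weight. Qed.

Lemma same_orbit_comp x y :
  same_orbit x y -> same_orbit (torus_comp fD x) (torus_comp fD y).
Proof. by case=> t xy; exists t; exact: translates_comp. Qed.

(** Laurent polynomials pull back to Laurent polynomials, hence so do closed sets and local
    fractions; [f_weight] makes the map equivariant. *)
Lemma quotient_morphism_comp :
  orbit_closed (qs_locus X) ->
  (forall x, qs_locus X x -> qs_locus X' (torus_comp fD x)) ->
  quotient_morphism (qs_locus X) (qs_locus X') (torus_comp fD).
Proof.
move=> Xinv fX; split=> // [x y _ _|]; first exact: same_orbit_comp.
move=> V [[Z Zcl VE] Vinv] VX'; split; first split.
- exists (torus_comp fD @^-1` Z); first exact: zariski_closed_comp.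
  rewrite VE; apply/seteqP; split=> x /=; first by case=> ? [].
  by case=> Xx nZ; split=> //; split=> //; exact: fX.
- move=> x y xy [Xx Vx]; split; first exact: Xinv xy Xx.
  exact: Vinv (same_orbit_comp xy) Vx.
- move=> h [hinv hreg]; split.
    by move=> x y xy [Xx Vx]; exact: hinv (same_orbit_comp xy) Vx.
  move=> x [Xx Vx]; have [a [b [aL bL bx hE]]] := hreg _ Vx.
  exists (a \o torus_comp fD), (b \o torus_comp fD).
  split=> //; [exact: laurent_comp | exact: laurent_comp |].
  by move=> y [Xy Vy]; exact: hE.
Qed.

End StackMorphism.

(** The dense open subsets can be the whole loci, as the induced maps are mutually inverse and
    equivariant. *)
Lemma birational_lattice_iso (X X' : torus_qstack R)
    (f : qs_lattice X' -> qs_lattice X) (g : qs_lattice X -> qs_lattice X')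
    (fD : {morph f : a b / a + b}) (gD : {morph g : a b / a + b}) :
  cancel f g -> cancel g f ->
  (forall l, qs_weight X (f l) = qs_weight X' l) ->
  orbit_closed (qs_locus X) -> orbit_closed (qs_locus X') ->
  (forall x, qs_locus X x -> qs_locus X' (torus_comp fD x)) ->
  (forall x, qs_locus X' x -> qs_locus X (torus_comp gD x)) ->
  birational X X'.
Proof.
move=> fK gK fq Xinv X'inv fX gX'.
have gq l : qs_weight X' (g l) = qs_weight X l by rewrite -fq gK.
have refl (Y : torus_qstack R) (x y : torus R (qs_lattice Y)) :
    x =1 y -> same_orbit x y.
  by move=> xy; exists 1; split=> [|l]; rewrite ?oner_eq0 // exp1rz mul1r xy.
exists (qs_locus X), (qs_locus X'), (torus_comp fD), (torus_comp gD); split.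
- by split; exact: dense_open_locus.
- by split; exact: quotient_morphism_comp.
- by move=> x _; apply: refl => l /=; rewrite gK.
- by move=> x _; apply: refl => l /=; rewrite fK.
- move=> x _; apply/seteqP; split=> t; first exact: translates_comp.
  (* Conversely, every character [l] equals [f (g l)], so the condition at [g l] gives the one at
     [l]. *)
  by case=> t0 xt; split=> // l; have /= := xt (g l); rewrite gK gq.
Qed.

End Torus.

(** * Exponent matrices and invariance of monomials *)

Lemma calabi_yau_det_neq0 n (P : 'M[nat]_n) :
  calabi_yau P -> \det (int_mx P) != 0.
Proof.
case=> + _ _.
have -> : map_mx (fun k : nat => k%:R : rat) P = map_mx intr (int_mx P).
  by apply/matrixP => i j; rewrite !mxE.
by rewrite unitmxE unitfE det_map_mx intr_eq0.
Qed.

Lemma int_mx_tr n m (P : 'M[nat]_(n, m)) : int_mx P^T = (int_mx P)^T.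
Proof. by apply/matrixP => i j; rewrite !mxE. Qed.

(* The monomials of W take the values 2^det(P) (the j-th one) and 1 (the others)
   at the point with coordinates 2^adj(P)_(j, i). *)
Lemma invariant_columns (R : realType) n (P : 'M[nat]_n)
    (G : set (torus R 'cV[int]_n)) :
  \det (int_mx P) != 0 -> invariant_under P G ->
  forall v, int_mx P *m v \in invlat_pred G.
Proof.
move=> detP invP v; apply/invlat_predP => g Gg.
suff gcol j : g (int_mx P *m delta_mx j 0) = 1.
  rewrite [v]col_sum_delta raddf_sum (big_morph g (tvalD g) (tval0 g)).
  by rewrite big1 // => j _; rewrite raddfMz tvalMz gcol exp1rz.
pose c k := g (int_mx P *m delta_mx k 0).
pose mon (z : 'cV[R[i]]_n) k := \prod_(i < n) z i 0 ^+ P i k.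
have sum0 z : \sum_k (c k - 1) * mon z k = 0.
  under eq_bigr do rewrite mulrBl mul1r.
  rewrite sumrB; apply/eqP; rewrite subr_eq0 -[X in _ == X]/(poly_fun P z).
  rewrite -(invP g Gg z); apply/eqP.
  apply: eq_bigr => k _; rewrite /c -colE tval_col -big_split.
  by apply: eq_bigr => i _; rewrite !mxE exprMn.
pose z : 'cV[R[i]]_n := \col_i (2%:R ^ (\adj (int_mx P) j i)).
have monz k : mon z k = 2%:R ^ (\det (int_mx P) *+ (j == k)).
  have <- : (\adj (int_mx P) *m int_mx P) j k = \det (int_mx P) *+ (j == k).
    by rewrite mul_adj_mx !mxE.
  rewrite mxE (big_morph (fun e : int => (2%:R : R[i]) ^ e)
    (id1 := 1) (op1 := *%R)) //; last first.
    by move=> a b; rewrite expfzDr // pnatr_eq0.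
  by apply: eq_bigr => i _; rewrite !mxE exprnP exprz_exp.
have sumc : \sum_k (c k - 1) = 0.
  rewrite -[RHS](sum0 (const_mx 1)); apply: eq_bigr => k _.
  by rewrite /mon big1 ?mulr1 // => i _; rewrite mxE expr1n.
(* Subtracting the relation at (1, ..., 1) leaves (c_j - 1)(2^det(P) - 1) = 0, where the second
   factor is nonzero. *)
have := sum0 z; rewrite -[RHS]sumc => /eqP; rewrite -subr_eq0 -sumrB.
rewrite (bigD1 j) //= big1 ?addr0 => [|k kj]; last first.
  by rewrite monz eq_sym (negbTE kj) mulr0n mulr1 subrr.
rewrite monz eqxx mulr1n -[X in _ - X]mulr1 -mulrBr mulf_eq0 !subr_eq0.
by rewrite pexprz_eq1 ?ler0n // (negbTE detP) (eqr_nat _ 2 1) orbF => /eqP.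
Qed.

(** * The dual lattice and its identification through B *)

Section DualLattice.
Variables (R : realType) (n : nat) (G : set (torus R 'cV[int]_n)).
Variable P : 'M[nat]_n.
Hypothesis detP : \det (int_mx P) != 0.
Hypothesis invP : forall v, int_mx P *m v \in invlat_pred G.

Local Notation M := (invlat G).
Local Notation L := (invlat (dual_group P G)).
Local Notation B := (@Bdual R n n P G).

Lemma invlat_valMz (m : M) (k : int) :
  invlat_val (m *~ k) = invlat_val m *~ k.
Proof. exact: (raddfMz \val). Qed.

Lemma val_Btau v : invlat_val (Btau P G v) = int_mx P *m v.
Proof. exact: insubdK. Qed.

Lemma Btau_sum v : Btau P G v = \sum_j Btau P G (delta_mx j 0) *~ v j 0.
Proof.
apply: val_inj; rewrite raddf_sum /= val_Btau {1}[v]col_sum_delta raddf_sum.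
by apply: eq_bigr => j _; rewrite raddfMz invlat_valMz val_Btau.
Qed.

Lemma tau_Btau (phi : tau M) v :
  phi (Btau P G v) = ((Bmap P phi)^T *m v) 0 0.
Proof.
rewrite Btau_sum raddf_sum mxE; apply: eq_bigr => j _.
by rewrite raddfMz !mxE mulrzz.
Qed.

Lemma Btau_adj (m : M) :
  Btau P G (\adj (int_mx P) *m invlat_val m) = m *~ \det (int_mx P).
Proof.
apply: val_inj.
rewrite /= invlat_valMz val_Btau mulmxA mul_mx_adj mul_scalar_mx.
by rewrite -scaler_int intz.
Qed.

(** Cramer's rule: [phi] is the row vector B(phi)^T P^-1 restricted to M, with the denominator
    cleared. *)
Lemma tau_det (phi : tau M) (m : M) :
  phi m * \det (int_mx P) =
  ((Bmap P phi)^T *m \adj (int_mx P) *m invlat_val m) 0 0.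
Proof. by rewrite -mulmxA -tau_Btau Btau_adj raddfMz mulrzz. Qed.

Lemma Bmap_inj : injective (@Bmap R n n P G).
Proof.
move=> phi psi eB; apply: tauP => m.
by apply: (mulIf detP); rewrite !tau_det eB.
Qed.

Lemma BmapD : {morph (@Bmap R n n P G) : phi psi / phi + psi}.
Proof. by move=> phi psi; apply/colP => j; rewrite !mxE. Qed.

(* For m in M and a primitive root of unity z of order |det(P)|, the point
   u |-> z ^ (u^T adj(P) m) lies in G^T, so that u^T P^-1 m is an integer for
   all u in F((C^x)^n / G^T). *)
Lemma Bdual_surj (l : L) : exists phi : tau M, Bdual P phi = l.
Proof.
pose d := \det (int_mx P); pose v := invlat_val l.
have d_gt0 : (0 < `|d|)%N by rewrite absz_gt0.
have [z zP] := closed_prim_root_exists R[i] d_gt0.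
pose e (u w : 'cV[int]_n) := (u^T *m \adj (int_mx P) *m w) 0 0.
have eDl u u' w : e (u + u') w = e u w + e u' w.
  by rewrite /e raddfD !mulmxDl mxE.
have eDr u w w' : e u (w + w') = e u w + e u w'.
  by rewrite /e mulmxDr mxE.
have z0 : z != 0.
  apply/eqP => z0; have /eqP := prim_expr_order zP.
  by rewrite z0 expr0n gtn_eqF // eq_sym oner_eq0.
have dvd_e (m : M) : (d %| e v (invlat_val m))%Z.
  have y0 : z ^ e 0 (invlat_val m) = 1 by rewrite /e trmx0 !mul0mx mxE expr0z.
  have yD a b :
      z ^ e (a + b) (invlat_val m) = z ^ e a (invlat_val m) * z ^ e b (invlat_val m).
    by rewrite eDl expfzDr.
  (* At u = B(phi) the exponent is phi(m) det(P) by [tau_det], a multiple of the order of [z]. *)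
  have yG : dual_group P G (Torus y0 yD).
    move=> phi /=; apply/eqP.
    by rewrite /e -tau_det -(prim_order_dvdz _ zP) dvdzE abszM dvdn_mull.
  (* The invariant character [l] takes the value 1 at this point. *)
  have /eqP := invlat_predP _ _ (invlat_valP l) _ yG.
  by rewrite /= -(prim_order_dvdz _ zP).
have phiD : {morph (fun m : M => (e v (invlat_val m) %/ d)%Z) : a b / a + b}.
  by move=> a b; rewrite [invlat_val _](raddfD \val) eDr divzDl ?dvd_e.
have [phi phiE] := tau_of_additive phiD.
(* B(phi) = v follows by cancelling [d] in v^T adj(P) P = det(P) v^T. *)
exists phi; apply/val_inj/colP => j; rewrite mxE phiE val_Btau.
rewrite /e mulmxA -[v^T *m _ *m _]mulmxA mul_adj_mx mul_mx_scalar.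
by rewrite -scalemxAl mxE -colE !mxE mulKz.
Qed.

Lemma Bdual_inj : injective B.
Proof. by move=> phi psi [/Bmap_inj]. Qed.

Lemma BdualD : {morph B : phi psi / phi + psi}.
Proof. by move=> phi psi; apply: val_inj; rewrite /= BmapD. Qed.

Lemma Bdual_bij : exists gamma : L -> tau M,
  [/\ {morph gamma : a b / a + b}, cancel B gamma & cancel gamma B].
Proof.
have [gamma gammaK] := choice Bdual_surj; exists gamma; split=> //.
  by move=> a b; apply: Bdual_inj; rewrite BdualD !gammaK.
by move=> phi; apply: Bdual_inj; rewrite gammaK.
Qed.

Lemma AtauD (v : 'cV[int]_n) :
  (fun m : M => (v^T *m invlat_val m) 0 0) \in @tau_pred M.
Proof.
by apply/tau_predP => a b; rewrite [invlat_val _](raddfD \val) mulmxDr mxE.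
Qed.

(* A^tau : (Z^n)^tau -> M^tau *)
Definition Atau (v : 'cV[int]_n) : tau M := Tau (AtauD v).

(** The factorization P^tau = B o A^tau of the dual model. *)
Lemma Bmap_Atau v : Bmap P (Atau v) = int_mx P^T *m v.
Proof.
apply/colP => j; rewrite mxE /= val_Btau mulmxA -colE int_mx_tr !mxE.
by apply: eq_bigr => i _; rewrite !mxE mulrC.
Qed.

Lemma dual_rowP v : int_mx P^T *m v \in invlat_pred (dual_group P G).
Proof. by rewrite -Bmap_Atau Bmap_invlat. Qed.

(** Under B, the exponents of the dual monomials become A^tau(e_j), which depend on [G] alone. The
    default of [insubd] is excluded by [dual_rowP]. *)
Lemma Bdual_Atau v : Bdual P (Atau v) = Btau P^T (dual_group P G) v.
Proof.
apply: val_inj; rewrite /= Bmap_Atau.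
by rewrite [RHS]insubdK // dual_rowP.
Qed.

Lemma dual_weight_vectorsE :
  dual_weight_vectors P G =
  [set q | forall j k, q (Atau (delta_mx j 0 - delta_mx k 0)) = 0].
Proof.
apply/seteqP; split=> q.
  by case=> q' q'0 qq' j k; rewrite qq' Bdual_Atau.
have [gamma [gammaD BK _]] := Bdual_bij.
(* The weight vector on the invariant lattice is q o B^-1. *)
have [|q' q'E] := @tau_of_additive _ (q \o gamma).
  by move=> a b; rewrite /= gammaD raddfD.
move=> q0; exists q'; last by move=> phi; rewrite q'E /= BK.
by move=> j k; rewrite q'E -Bdual_Atau /= BK.
Qed.

Lemma AtauB u v : Atau (u - v) = Atau u - Atau v.
Proof. by apply: tauP => m; rewrite tauB /= raddfB mulmxBl !mxE. Qed.

Lemma dual_weight_const (q : tau (tau M)) i :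
  dual_weight_vectors P G q ->
  forall j, q (Atau (delta_mx j 0)) = q (Atau (delta_mx i 0)).
Proof.
rewrite dual_weight_vectorsE => qw j; have /eqP := qw j i.
by rewrite AtauB raddfB subr_eq0 => /eqP.
Qed.

End DualLattice.

(** * Cyclicity of the group of dual weight vectors *)

(** The injectivity of [Bmap] is applied to the dual model, with [P^T] and [dual_group P G]: the
    coordinates of the image of [q'] all equal the value of [q] at A^tau(e_i). *)
Lemma dual_weight_eq0 (R : realType) n (G : set (torus R 'cV[int]_n))
    (P : 'M[nat]_n) (q : tau (tau (invlat G))) i :
  \det (int_mx P) != 0 -> (forall v, int_mx P *m v \in invlat_pred G) ->
  dual_weight_vectors P G q -> q (Atau G (delta_mx i 0)) = 0 -> q = 0.
Proof.
move=> detP invP qw qi0; have [q' _ qq'] := qw.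
suff q'0 : q' = 0 by apply: tauP => phi; rewrite qq' q'0.
have detPT : \det (int_mx P^T) != 0 by rewrite int_mx_tr det_tr.
apply: (Bmap_inj detPT (dual_rowP invP)).
apply/colP => j.
by rewrite !mxE -Bdual_Atau // -qq' (dual_weight_const detP invP i qw) qi0.
Qed.

Lemma dual_weight_cyclic (R : realType) n (G : set (torus R 'cV[int]_n.+1))
    (P : 'M[nat]_n.+1) :
  \det (int_mx P) != 0 -> (forall v, int_mx P *m v \in invlat_pred G) ->
  exists q0, generates q0 (dual_weight_vectors P G).
Proof.
move=> detP invP; pose c := tau_eval (Atau G (delta_mx 0 0)).
apply: (@generates_of_int _ _ c).
- by rewrite dual_weight_vectorsE.
- by rewrite dual_weight_vectorsE // => p q + + j k => /(_ j k) pE /(_ j k) qE;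
    rewrite tauB pE qE subrr.
- by move=> q; exact: dual_weight_eq0.
Qed.

(** * Comparison of the sigma-models *)

(** All monomials have weight [c], so the potential is multiplied by t^c under the action of t. *)
Lemma sigma_model_orbit_closed (R : realType) n m (P : 'M[nat]_(n, m))
    (G : set (torus R 'cV[int]_n)) (q : tau (invlat G)) (c : int) :
  (forall j, q (Btau P G (delta_mx j 0)) = c) ->
  orbit_closed (qs_locus (sigma_model P q)).
Proof.
move=> qc x y [t [_ xy]] /= x0; rewrite /quotient_potential.
under eq_bigr do rewrite xy /= qc.
by rewrite -mulr_sumr -/(quotient_potential P x) x0 mulr0.
Qed.

Lemma sigma_model_dual_birational (R : realType) n
    (G : set (torus R 'cV[int]_n.+1)) (P P' : 'M[nat]_n.+1)
    (q0 : tau (tau (invlat G)))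
    (q : tau (invlat (dual_group P G))) (q' : tau (invlat (dual_group P' G))) :
  \det (int_mx P) != 0 -> \det (int_mx P') != 0 ->
  (forall v, int_mx P *m v \in invlat_pred G) ->
  (forall v, int_mx P' *m v \in invlat_pred G) ->
  dual_weight_vectors P G q0 -> corresponds q0 q -> corresponds q0 q' ->
  birational (sigma_model P^T q) (sigma_model P'^T q').
Proof.
move=> detP detP' invP invP' q0w q0q q0q'.
have [gamma [gammaD BK gammaK]] := Bdual_bij detP invP.
have [gamma' [gamma'D BK' gammaK']] := Bdual_bij detP' invP'.
(* Points pull back along lattice maps, so the map from the first model to the second comes from B o
   B'^-1. *)
have fD : {morph (Bdual P (G:=G) \o gamma') : a b / a + b}.
  by move=> a b; rewrite /= gamma'D BdualD.
have gD : {morph (Bdual P' (G:=G) \o gamma) : a b / a + b}.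
  by move=> a b; rewrite /= gammaD BdualD.
have qc := dual_weight_const detP invP 0 q0w.
apply: (@birational_lattice_iso _ (sigma_model P^T q)
  (sigma_model P'^T q') _ _ fD gD).
- by move=> l /=; rewrite BK gammaK'.
- by move=> l /=; rewrite BK' gammaK.
- by move=> l /=; rewrite -q0q q0q' gammaK'.
- by apply: sigma_model_orbit_closed => j; rewrite -Bdual_Atau // -q0q qc.
- by apply: sigma_model_orbit_closed => j; rewrite -Bdual_Atau // -q0q' qc.
(* B o B'^-1 matches the monomials of the two potentials: both are images of A^tau(e_j). *)
- move=> x /= x0; rewrite -[RHS]x0; apply: eq_bigr => j _ /=.
  by rewrite -!Bdual_Atau // BK'.
- move=> x /= x0; rewrite -[RHS]x0; apply: eq_bigr => j _ /=.
  by rewrite -!Bdual_Atau // BK.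
Qed.

Theorem corollary3p7 (R : realType) (n : nat)
    (G : set (torus R 'cV[int]_n.+1)) (P P' : 'M[nat]_n.+1) :
  closed_subgroup G ->
  calabi_yau P -> calabi_yau P' ->
  invariant_under P G -> invariant_under P' G ->
  [/\ dual_weight_vectors P G = dual_weight_vectors P' G,
      exists q0, generates q0 (dual_weight_vectors P G) &
      forall q0, generates q0 (dual_weight_vectors P G) ->
      forall (q : tau (invlat (dual_group P G)))
             (q' : tau (invlat (dual_group P' G))),
        corresponds q0 q -> corresponds q0 q' ->
        birational (sigma_model P^T q) (sigma_model P'^T q')].
Proof.
move=> _ /calabi_yau_det_neq0 detP /calabi_yau_det_neq0 detP'.
move=> /(invariant_columns detP) invP /(invariant_columns detP') invP'.
split; first by rewrite !dual_weight_vectorsE.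
  exact: dual_weight_cyclic.
move=> q0 q0gen q q'; apply: sigma_model_dual_birational => //.
by rewrite q0gen; exists 1.
Qed.
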